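(* There exists a constant $c_0<1$ such that for every positive integer $n$, every intersecting set $S\subseteq\mathrm{AGL}(n,2)$ with $|S|\ge c_0|\mathrm{GL}(n,2)|$ is contained in a canonical intersecting set of $\mathrm{AGL}(n,2)$, i.e. there exist $\alpha,\beta\in\mathbb{F}_2^n$ with $S\subseteq\{g: g(\alpha)=\beta\}$.
   Context: $\mathrm{AGL}(n,2)=\mathrm{GL}(n,2)\ltimes V$, $V=\mathbb{F}_2^n$, with elements $(M,v)$, product $(M_1,v_1)(M_2,v_2)=(M_1M_2,v_1+M_1v_2)$, acting on $V$ by $(M,v)\cdot w=v+Mw$. Two elements $g_1,g_2$ are intersecting if $g_1g_2^{-1}$ fixes a point of $V$; an intersecting set is a set of pairwise intersecting elements. Canonical intersecting sets are the sets $\{g: g(\alpha)=\beta\}$, $\alpha,\beta\in V$ (each of size $|\mathrm{GL}(n,2)|$). *)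

(* Defs.v *)
From HB Require Import structures.
From mathcomp Require Import all_boot all_order all_algebra all_fingroup.
From mathcomp Require Import reals.

Set Implicit Arguments.
Unset Strict Implicit.
Unset Printing Implicit Defensive.

Import GRing.Theory.
Local Open Scope ring_scope.

(* MathComp's {'GL_n(2)} consists of matrices of size n.-1.+1, which is n for
   n > 0; vectors use the same dimension.  For n = 0 these types are those of
   dimension 1, so statements below must assume 0 < n. *)
Notation F2vec n := 'cV['F_2]_n.-1.+1.

Record AGL (n : nat) : predArgType :=
  Aff { aff_lin : {'GL_n(2)}; aff_trans : F2vec n }.

Section AGLGroup.

Variable n : nat.
Implicit Types (g h : AGL n) (w a b : F2vec n).

Definition aff_pair g := (aff_lin g, aff_trans g).
Definition aff_of_pair (p : {'GL_n(2)} * F2vec n) := Aff p.1 p.2.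

Lemma aff_pairK : cancel aff_pair aff_of_pair.
Proof. by case. Qed.

HB.instance Definition _ := Countable.copy (AGL n) (can_type aff_pairK).
HB.instance Definition _ : isFinite (AGL n) := CanIsFinite aff_pairK.

Definition aff_mx g : 'M['F_2]_n.-1.+1 := GLval (aff_lin g).

Definition aff_mul g1 g2 : AGL n :=
  Aff (aff_lin g1 * aff_lin g2)%g (aff_trans g1 + aff_mx g1 *m aff_trans g2).

Definition aff_one : AGL n := Aff 1%g 0.

Definition aff_inv g : AGL n :=
  Aff (aff_lin g)^-1%g (- (invmx (aff_mx g) *m aff_trans g)).

Lemma aff_mulmx g1 g2 : aff_mx (aff_mul g1 g2) = aff_mx g1 *m aff_mx g2.
Proof. by []. Qed.

Lemma aff_mulA : associative aff_mul.
Proof.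
move=> g1 g2 g3; congr Aff; first exact: mulgA.
by rewrite aff_mulmx /= mulmxDr mulmxA addrA.
Qed.

Lemma aff_mul1 : left_id aff_one aff_mul.
Proof.
by move=> [M u]; congr Aff; [exact: mul1g | rewrite mul1mx add0r].
Qed.

Lemma aff_mulV : left_inverse aff_one aff_inv aff_mul.
Proof.
by move=> [M u]; congr Aff; [exact: mulVg | exact: addNr].
Qed.

HB.instance Definition _ :=
  Finite_isGroup.Build (AGL n) aff_mulA aff_mul1 aff_mulV.

Definition aff_act g w : F2vec n := aff_trans g + aff_mx g *m w.

Lemma aff_act1 w : aff_act 1%g w = w.
Proof. by rewrite /aff_act mul1mx add0r. Qed.

(* A left action, unlike the right actions of action.v. *)
Lemma aff_actM g h w : aff_act (g * h)%g w = aff_act g (aff_act h w).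
Proof.
by rewrite /aff_act [aff_mx _]aff_mulmx mulmxDr mulmxA addrA.
Qed.

Definition intersecting g1 g2 : bool :=
  [exists w, aff_act (g1 * g2^-1)%g w == w].

Definition intersecting_set (S : {set AGL n}) : Prop :=
  {in S &, forall g1 g2, intersecting g1 g2}.

Definition canonical_set a b : {set AGL n} := [set g | aff_act g a == b].

Lemma card_canonical_set a b : #|canonical_set a b| = #|'GL_n(2)%g|.
Proof.
pose f (M : {'GL_n(2)}) : AGL n := Aff M (b - aff_mx (Aff M 0) *m a).
have f_inj : injective f by move=> M N [].
rewrite -(card_imset _ f_inj); apply: eq_card => -[M u].
rewrite inE /aff_act; apply/eqP/imsetP => [eq_b | [N _ [-> ->]]].
  by exists M; rewrite ?inE // /f -eq_b addrK.
exact: subrK.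
Qed.

End AGLGroup.

(* Main.v *)
(* If g1 = (M1, v1) and g2 = (M2, v2) agree at a point, then every row vector x
   with x M1 = x M2 satisfies x v1 = x v2.  So an intersecting set S contains at
   most one element for each linear part, and x v = F(x, x M) for all (M, v) in
   S, with a single function F of two row vectors; S lies in a canonical set as
   soon as F(x, y) = x beta + y alpha at all the points (x, x M).

   If S has density close to 1 and N = 2^n is large, then F passes the
   Blum-Luby-Rubinfeld linearity test with failure probability O(1/N) plus a
   small constant, so F is close to an additive function, which provides alpha
   and beta; double counting shows that all but a small fraction of S lies in
   the canonical set.  An element g of S outside it has linear part M and a
   nonzero defect u such that no g' of S inside it, with linear part M', has
   x M' = x M for some x with x u != 0.  By Bonferroni this excludes 3/8 of
   GL(n, 2), which is too much.

   For the finitely many remaining n, c0 is taken so close to 1 that S has an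
   element for each linear part.  Then F is additive on all pairs of points in
   general position, and an exact argument gives alpha and beta. *)
Require Import Defs.
From HB Require Import structures.
From mathcomp Require Import all_boot all_order all_algebra all_fingroup.
From mathcomp Require Import reals zify ring.

Set Implicit Arguments.
Unset Strict Implicit.
Unset Printing Implicit Defensive.

Import GRing.Theory.
Local Open Scope ring_scope.

(** * Vectors over F_2 and the linearity test *)

Lemma F2P (a : 'F_2) : a = 0 \/ a = 1.
Proof. by case: a => [[|[|//]]] i; [left | right]; apply/val_inj. Qed.

Lemma F2_neq (a b c : 'F_2) : a != b -> c != b -> a = c.
Proof. by case: (F2P a) (F2P b) (F2P c) => -> [] -> [] ->. Qed.

Lemma F2_addxx (a : 'F_2) : a + a = 0.
Proof. by case: (F2P a) => ->; apply/val_inj. Qed.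

Lemma addxx_F2 m n (A : 'M['F_2]_(m, n)) : A + A = 0.
Proof. by apply/matrixP => i j; rewrite !mxE F2_addxx. Qed.

Lemma card_pair_dep (S T : finType) (P : pred S) (Q : S -> pred T) :
  #|[set p : S * T | P p.1 && Q p.1 p.2]| =
  (\sum_(x | P x) #|[set y | Q x y]|)%N.
Proof.
rewrite -sum1dep_card -(pair_big_dep P Q (fun _ _ => 1%N)).
by apply: eq_bigr => x _; rewrite sum1dep_card.
Qed.

Section LinearityTest.

Variables (W : finZmodType) (F : W -> 'F_2).
Hypothesis addxx : forall x : W, x + x = 0.

Definition linearity_bad := [set p : W * W | F (p.1 + p.2) != F p.1 + F p.2].

(** For additive [F] every [y] votes for the value [F x]. *)
Local Notation vote x y := (F (x + y) + F y)%R.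
Local Notation votes x v := #|[set y | vote x y == v]|.

Definition majority x : 'F_2 :=
  if (votes x 1%R <= votes x 0%R)%N then 0 else 1.

Lemma votes_majority x v : (votes x v <= votes x (majority x))%N.
Proof.
rewrite /majority; case: ifP => h; case: (F2P v) => -> //.
by apply: ltnW; rewrite ltnNge h.
Qed.


Lemma majority_half x : (#|W| <= 2 * votes x (majority x))%N.
Proof.
set A : {set W} := [set y | _].
have CA : (#|~: A| <= #|A|)%N.
  apply: (leq_trans _ (votes_majority x (majority x + 1)%R)).
  apply/subset_leq_card/subsetP => y; rewrite !inE => h.
  by apply/eqP/(F2_neq h); case: (F2P (majority x)) => ->.
by rewrite mul2n -addnn -(cardsC A) leq_add2l.
Qed.

(** If [y] dissents from the majority at [x] and [z] does not, then one of [(y, z)] and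
    [(x + y, x + z)] is bad, because both pairs have the sum [y + z]. At least half of all [z] agree
    with the majority. *)
Lemma dissent_le x :
  (#|[set y | vote x y != majority x]| * #|W| <= 4 * #|linearity_bad|)%N.
Proof.
set D := [set y | _]; set A := [set y | vote x y == majority x].
have AD : (#|A| + #|D| = #|W|)%N.
  by rewrite -(cardsC A); congr (_ + _)%N; apply: eq_card => y; rewrite !inE.
have DA : (#|W| <= 2 * #|A|)%N by exact: majority_half.
pose sh (p : W * W) := (x + p.1, x + p.2).
have sh_inj : injective sh by move=> [a b] [c d] [/addrI-> /addrI->].
have sub : setX D A \subset linearity_bad :|: sh @^-1: linearity_bad.
  apply/subsetP => -[y z]; rewrite !inE /= => /andP[Dy /eqP Az].
  rewrite addrACA addxx add0r -negb_and.
  apply: contra Dy => /andP[/eqP e1 /eqP e2].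
  rewrite -{}Az; move: e2; rewrite {}e1.
  move: (F y) (F z) (F (x + y)) (F (x + z)) => a b c d.
  by case: (F2P a) (F2P b) (F2P c) (F2P d) => -> [] -> [] -> [] ->.
have shK : #|sh @^-1: linearity_bad| = #|linearity_bad|.
  apply: on_card_preimset; exists (fun p => (p.1 - x, p.2 - x)) => -[a b] _;
  by rewrite /sh /= !(addrC x) ?addrK ?subrK.
have: (#|D| * #|A| <= 2 * #|linearity_bad|)%N.
  rewrite -cardsX (leq_trans (subset_leq_card sub)) //.
  by rewrite (leq_trans (leq_card_setU _ _)) // shK mul2n addnn.
move: DA AD; nia.
Qed.

(* The self-correction argument of Blum, Luby and Rubinfeld. *)
Lemma linearity_test :
  (12 * #|linearity_bad| < #|W| ^ 2)%N ->
  {morph majority : x y / x + y} /\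
  (#|[set x | F x != majority x]| * #|W| <= 2 * #|linearity_bad|)%N.
Proof.
move=> few; split=> [x y|].
  pose D (t : W) : {set W} := [set z | vote t z != majority t].
  (* As [12 = 3 * 4], each dissent set fills less than a third of [W]. So some [z] makes the votes
     for [x] and [x + y] at [z], and for [y] at [x + z], all majority votes; these three sum to
     0. *)
  have D_lt t : (3 * #|D t| < #|W|)%N.
    have: (#|D t| * #|W| <= 4 * #|linearity_bad|)%N := dissent_le t.
    by move: few; nia.
  pose D' := [set z : W | x + z \in D y].
  have D'_le : (#|D'| <= #|D y|)%N.
    rewrite -(card_imset _ (@addrI _ x)); apply: subset_leq_card.
    by apply/subsetP => _ /imsetP[z + ->]; rewrite inE.
  have : (#|D x :|: D' :|: D (x + y)%R| < #|W|)%N.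
    have := D_lt x; have := D_lt y; have := D_lt (x + y).
    have [+ _] := leq_card_setU (D x :|: D') (D (x + y)%R).
    have [+ _] := leq_card_setU (D x) D'.
    by lia.
  rewrite ltnNge -cardsT => /negP nsub.
  have /subsetPn[z _] : ~~ ([set: W] \subset D x :|: D' :|: D (x + y)).
    by apply/negP => /subset_leq_card.
  rewrite !inE !negb_or !negbK => /andP[/andP[/eqP <- /eqP <-] /eqP <-].
  rewrite !addrA [y + x]addrC.
  move: (F z) (F (x + z)) (F (x + y + z)) => a b c.
  by case: (F2P a) (F2P b) (F2P c) => -> [] -> [] ->; apply/val_inj.
pose E := [set x | F x != majority x].
(* Where [F x] is not the majority, each [y] that votes with the majority gives a bad pair
   [(x, y)]. *)
have sub : [set p : W * W | (p.1 \in E) && (vote p.1 p.2 == majority p.1)]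
    \subset linearity_bad.
  apply/subsetP => -[x y]; rewrite !inE /= => /andP[ne /eqP e].
  apply: contra ne => /eqP h; rewrite -e h.
  move: (F x) (F y) => a b.
  by case: (F2P a) (F2P b) => -> [] ->.
have := subset_leq_card sub.
rewrite (card_pair_dep (mem E) (fun x y => vote x y == majority x)) => le_bad.
apply: (@leq_trans (2 * \sum_(x in E) votes x (majority x)));
  last by rewrite leq_mul2l.
rewrite -sum1_card big_distrl big_distrr /=; apply: leq_sum => x _.
rewrite mul1n; exact: majority_half.
Qed.

End LinearityTest.

(** * Transitivity of GL(n, 2) on tuples of independent rows *)

Section GLFibers.

Variables n m : nat.
Local Notation rows := 'M['F_2]_(m, n.-1.+1).

Lemma row_freeM_GL (X : rows) (M : {'GL_n(2)}) :
  row_free (X *m GLval M) = row_free X.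
Proof. by rewrite /row_free mxrankMfree // row_free_unit GL_unitmx. Qed.

Lemma GL_transitive (U T : rows) :
  row_free U -> row_free T -> exists M : {'GL_n(2)}, U *m GLval M = T.
Proof.
move=> fU fT; pose f := pinvmx U *m T.
have Uf : U *m f = T by rewrite /f mulmxA mulmxVp // mul1mx.
have [|g g_unit Ug] := @complete_unitmx 'F_2 m _ U f.
  by rewrite Uf (eqP fU) (eqP fT).
by exists (FinRing.Unit g_unit); rewrite -Uf Ug.
Qed.

Definition GLfiber (U T : rows) := [set M : {'GL_n(2)} | U *m GLval M == T].

Definition row_frees := [set X : rows | row_free X].

(** Right translation by an [h] with [T h = X] carries the fiber over [T] onto the fiber over [X],
    so GL splits into equal fibers. *)
Lemma card_GLfiber (U T : rows) : row_free U -> row_free T ->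
  (#|GLfiber U T| * #|row_frees| = #|'GL_n(2)%g|)%N.
Proof.
move=> fU fT.
have fib X : row_free X ->
    #|[set M : {'GL_n(2)} | U *m GLval M == X]| = #|GLfiber U T|.
  move=> fX; have [h Th] := GL_transitive fT fX.
  rewrite -[RHS](card_imset _ (mulIg h)); apply: eq_card => M.
  rewrite inE; apply/eqP/imsetP => [eX | [M' + ->]].
    exists (M * h^-1)%g; rewrite ?mulgKV // inE GL_MxE GL_VxE mulmxA eX -Th.
    by rewrite mulmxK // GL_unitmx.
  by rewrite inE GL_MxE mulmxA => /eqP->.
rewrite cardsT -[RHS]sum1_card.
rewrite (partition_big (fun M => U *m GLval M) (mem row_frees)) /=.
  rewrite mulnC -sum_nat_const; apply: eq_bigr => X; rewrite inE => fX.
  by rewrite sum1dep_card (fib X).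
by move=> M _; rewrite inE row_freeM_GL.
Qed.

End GLFibers.

(** * Counting independent rows and linear functionals over F_2 *)

Lemma row_free_rV (F : fieldType) n (u : 'rV[F]_n) : row_free u = (u != 0).
Proof. by rewrite /row_free rank_rV eqb1. Qed.

Lemma row_free_col_F2 n (a b : 'rV['F_2]_n) :
  row_free (col_mx a b) = [&& a != 0, b != 0 & a != b].
Proof.
apply/idP/and3P => [free_ab | [a0 b0 ab]].
  have inj (x y : 'F_2) : x *: a + y *: b = 0 -> x = 0 /\ y = 0.
    move=> e; have : row_mx x%:M y%:M = 0 :> 'rV_(1 + 1).
      apply: (row_free_inj free_ab).
      by rewrite mul0mx mul_row_col !mul_scalar_mx.
    by rewrite -row_mx0 => /eq_row_mx[/matrixP/(_ 0 0) + /matrixP/(_ 0 0)];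
      rewrite !mxE !mulr1n.
  split; apply/eqP=> e.
  - by have [] := inj 1 0; rewrite ?e ?scaler0 ?scale0r ?addr0.
  - by have [] := inj 0 1; rewrite ?e ?scaler0 ?scale0r ?addr0.
  - by have [] := inj 1 1; rewrite ?e ?scale1r ?addxx_F2.
apply: inj_row_free => v; rewrite -[v]hsubmxK mul_row_col.
rewrite [lsubmx v]mx11_scalar [rsubmx v]mx11_scalar !mul_scalar_mx.
have [-> | ->] := F2P (lsubmx v 0 0); have [-> | ->] := F2P (rsubmx v 0 0);
  rewrite ?scale0r ?scale1r ?addr0 ?add0r.
- by move=> _; rewrite !raddf0 row_mx0.
- by move/eqP; rewrite (negPf b0).
- by move/eqP; rewrite (negPf a0).
- move/eqP; rewrite addr_eq0 => /eqP e; case/eqP: ab.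
  by rewrite e; apply/esym/eqP; rewrite -addr_eq0 addxx_F2.
Qed.

Lemma card_row_frees1 n :
  #|row_frees n 1| = (2 ^ n.-1.+1).-1.
Proof.
have -> : row_frees n 1 = ~: [set 0].
  by apply/setP => u; rewrite !inE row_free_rV.
by have := cardsC1 (0 : 'rV['F_2]_n.-1.+1); rewrite card_mx card_Fp // mul1n.
Qed.

Lemma card_row_frees2 n :
  #|row_frees n (1 + 1)| = ((2 ^ n.-1.+1).-1 * (2 ^ n.-1.+1).-2)%N.
Proof.
pose pairs := [set p : 'rV['F_2]_n.-1.+1 * 'rV['F_2]_n.-1.+1 |
  (p.1 != 0) && (p.2 \in ~: [set 0; p.1])].
have -> : #|row_frees n (1 + 1)| = #|pairs|.
  have inj : injective
      (fun p : 'rV['F_2]_n.-1.+1 * 'rV['F_2]_n.-1.+1 => col_mx p.1 p.2).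
    by move=> [a b] [c e] /= /eq_col_mx[-> ->].
  rewrite -[RHS](card_imset _ inj); apply: eq_card => X; rewrite -[X]vsubmxK.
  rewrite inE row_free_col_F2.
  apply/and3P/imsetP => [[a0 b0 ab] | [[a b] + /eq_col_mx[-> ->]]].
    by exists (usubmx X, dsubmx X); rewrite // !inE a0 negb_or b0 eq_sym ab.
  by rewrite !inE negb_or [b == a]eq_sym => /and3P.
rewrite (card_pair_dep (fun u => u != 0) (fun u v => v \in ~: [set 0; u])).
rewrite (eq_bigr (fun _ => (2 ^ n.-1.+1).-2)).
  rewrite sum_nat_const -card_row_frees1; congr (_ * _)%N.
  by apply: eq_card => u; rewrite inE row_free_rV.
move=> u u0; have := cardsC [set 0; u].
rewrite cards2 eq_sym u0 card_mx card_Fp // mul1n.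
rewrite (_ : [set v | _] = ~: [set 0; u]) => [<- // | ].
by apply/setP => v; rewrite inE.
Qed.

Lemma F2_additive_repr m (g : 'rV['F_2]_m -> 'F_2) :
  {morph g : x y / x + y} ->
  exists gamma : 'cV['F_2]_m, forall x, g x = (x *m gamma) 0 0.
Proof.
move=> gD; exists (\col_j g (delta_mx 0 j)) => x.
have g0 : g 0 = 0 by apply: (addrI (g 0)); rewrite -gD !addr0.
rewrite [in LHS](row_sum_delta x) (big_morph g gD g0) mxE.
apply: eq_bigr => j _; rewrite mxE.
by case: (F2P (x 0 j)) => ->; rewrite ?scale0r ?scale1r ?mul0r ?mul1r.
Qed.

Lemma eq_mul_rV m n (A B : 'M['F_2]_(m, n)) :
  (forall x : 'rV_m, x *m A = x *m B) -> A = B.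
Proof. by move=> e; apply/row_matrixP => i; rewrite !rowE e. Qed.

Lemma card_rV_F2 m : #|{: 'rV['F_2]_m}| = (2 ^ m)%N.
Proof. by rewrite card_mx card_Fp // mul1n. Qed.

(** Translation by one nonorthogonal row exchanges the set with its complement. *)
Lemma card_nonorthogonal m (u : 'cV['F_2]_m) :
  u != 0 -> (2 * #|[set x : 'rV_m | ((x *m u) 0 0 != 0)%R]| = 2 ^ m)%N.
Proof.
move=> u0; set H := [set x | _].
have [x0 x0u] : exists x0 : 'rV_m, (x0 *m u) 0 0 != 0.
  have /cV0Pn[i ui] := u0; exists (delta_mx 0 i).
  by rewrite -rowE mxE.
rewrite -card_rV_F2 -(cardsC H) mul2n -addnn; congr (_ + _)%N.
rewrite -[LHS](card_imset _ (addrI x0)); apply: eq_card => x.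
rewrite !inE negbK; apply/imsetP/eqP => [[y + ->] | xu].
  rewrite inE => yu; rewrite mulmxDl mxE; move: yu x0u.
  move=> yu x0u; rewrite (F2_neq yu (_ : 1 != 0)) //.
  by rewrite (F2_neq x0u (_ : 1 != 0)) ?F2_addxx.
exists (x0 + x); last by rewrite addrA addxx_F2 add0r.
by rewrite inE mulmxDl mxE xu addr0.
Qed.

Lemma card_exchange (S T : finType) (A : {set S}) (Q : S -> pred T) :
  (\sum_(y : T) #|[set x in A | Q x y]| = \sum_(x in A) #|[set y | Q x y]|)%N.
Proof.
under eq_bigr do rewrite -sum1dep_card big_mkcondr.
rewrite exchange_big; apply: eq_bigr => x _.
by rewrite -sum1dep_card [RHS]big_mkcond.
Qed.

(** * A lower bound for the linear parts that a nonzero defect excludes *)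

Section Bonferroni.

Variables (n : nat) (M : {'GL_n(2)}) (u : 'cV['F_2]_n.-1.+1).
Local Notation d := n.-1.+1.

(** When [M] and [u] are the linear part and the defect of an element of an intersecting set, no
    element of that set with zero defect has its linear part here. *)
Definition meeting_set : {set {'GL_n(2)}} :=
  [set M' : {'GL_n(2)} | [exists x : 'rV['F_2]_d,
    ((x *m u) 0 0 != 0) && (x *m GLval M' == x *m GLval M)]].

(* Second Bonferroni inequality for the events [x *m M' = x *m M], with [x]
   ranging over the 2 ^ d / 2 rows such that [x *m u != 0]. *)
Lemma card_meeting_set : (1 < d)%N -> u != 0 ->
  (3 * 2 ^ d * #|'GL_n(2)%g| <= 8 * #|meeting_set| * (2 ^ d).-1)%N.
Proof.
move=> d_gt1 u0; set G := #|'GL_n(2)%g|.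
pose H := [set x : 'rV['F_2]_d | (x *m u) 0 0 != 0].
have cardH : (2 * #|H| = 2 ^ d)%N := card_nonorthogonal u0.
have H0 x : x \in H -> x != 0.
  by apply: contraTneq => ->; rewrite inE mul0mx mxE eqxx.
pose X (M' : {'GL_n(2)}) : {set 'rV_d} :=
  [set x in H | x *m GLval M' == x *m GLval M].
pose pairs := [set p : 'rV['F_2]_d * 'rV['F_2]_d |
  (p.1 \in H) && (p.2 \in H :\ p.1)].
pose Y (M' : {'GL_n(2)}) := [set p in pairs |
  (p.1 *m GLval M' == p.1 *m GLval M) && (p.2 *m GLval M' == p.2 *m GLval M)].
have sumX : (\sum_M' #|X M'| * (2 ^ d).-1 = #|H| * G)%N.
  rewrite -big_distrl /= card_exchange big_distrl /= -sum_nat_const.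
  apply: eq_bigr => x xH.
  have free_x : row_free x by rewrite row_free_rV H0.
  have free_xM : row_free (x *m GLval M) by rewrite row_freeM_GL.
  by rewrite /G -(card_GLfiber free_x free_xM) card_row_frees1.
have cardpairs : #|pairs| = (#|H| * #|H|.-1)%N.
  rewrite (card_pair_dep (fun x => x \in H) (fun x y => y \in H :\ x)).
  rewrite -sum_nat_const; apply: eq_bigr => x xH.
  by rewrite (cardsD1 x H) xH; apply: eq_card => y; rewrite inE.
have sumY :
    (\sum_M' #|Y M'| * ((2 ^ d).-1 * (2 ^ d).-2) = #|H| * #|H|.-1 * G)%N.
  rewrite -big_distrl /= card_exchange big_distrl /= -cardpairs -sum_nat_const.
  apply: eq_bigr => -[x y]; rewrite !inE /= => /and3P[xH yx yH].
  have free_xy : row_free (col_mx x y).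
    by rewrite row_free_col_F2 !H0 ?inE // eq_sym.
  have free_xyM : row_free (col_mx x y *m GLval M) by rewrite row_freeM_GL.
  rewrite /G -(card_GLfiber free_xy free_xyM) card_row_frees2; congr (_ * _)%N.
  apply: eq_card => M'; rewrite !inE !mul_col_mx.
  by apply/andP/eqP => [[/eqP-> /eqP->] // | /eq_col_mx[-> ->]].
(* With [k = #|X M'|] this is [2k <= 2[k > 0] + k(k - 1)]; [Y] counts ordered pairs. *)
have pointwise M' : (2 * #|X M'| <= 2 * (M' \in meeting_set) + #|Y M'|)%N.
  have -> : #|Y M'| = (#|X M'| * #|X M'|.-1)%N.
    transitivity #|[set p | (p.1 \in X M') && (p.2 \in X M' :\ p.1)]|.
      apply: eq_card => -[x y]; rewrite !inE /=.
      by do ![case: (_ == _) | case: (_ != _)].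
    rewrite (card_pair_dep (fun x => x \in X M') (fun x y => y \in X M' :\ x)).
    rewrite -sum_nat_const; apply: eq_bigr => x xH.
    by rewrite (cardsD1 x (X M')) xH; apply: eq_card => y; rewrite inE.
  case: (posnP #|X M'|) => [-> // | X_gt0].
  have -> : M' \in meeting_set.
    have /card_gt0P[x] := X_gt0; rewrite !inE => xX.
    by apply/existsP; exists x.
  by nia.
have: (2 * \sum_M' #|X M'| <= 2 * #|meeting_set| + \sum_M' #|Y M'|)%N.
  rewrite -sum1_card [X in (_ <= 2 * X + _)%N]big_mkcond /=.
  rewrite !big_distrr -big_split /=.
  apply: leq_sum => M' _; apply: leq_trans (pointwise M') _.
  by rewrite leq_add2r; case: (_ \in _).
have N_gt3 : (3 < 2 ^ d)%N by rewrite (@leq_exp2l 2 2).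
move: sumX sumY; rewrite -!big_distrl /=.
move: (\sum_M' #|X M'|)%N (\sum_M' #|Y M'|)%N => x y.
move: cardH N_gt3; move: (2 ^ d)%N #|H| #|meeting_set| => N h B.
clear; move=> hN N_gt3 eX eY le.
(* Since [N = 2h], the factor [N - 2 = 2(h - 1)] cancels against [h - 1]. *)
have {}eY : (y * N.-1 * 2 = h * G)%N.
  apply/eqP; rewrite -(eqn_pmul2r (_ : 0 < h.-1)%N); last by lia.
  by apply/eqP; nia.
by nia.
Qed.

End Bonferroni.

(** * Intersecting sets *)

Section IntersectingSet.

Variables (n : nat) (S : {set AGL n}).
Hypothesis S_int : intersecting_set S.
Local Notation d := n.-1.+1.
Local Notation row := 'rV['F_2]_d.

(** If [g h^-1] fixes [w], then [g] and [h] agree at [h^-1 w]; multiplying by [x] there, the linear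
    terms cancel. *)
Lemma intersecting_agree g h (x : row) : g \in S -> h \in S ->
  x *m aff_mx g = x *m aff_mx h -> x *m aff_trans g = x *m aff_trans h.
Proof.
move=> gS hS e; have /existsP[w /eqP] := S_int gS hS.
set w' := aff_act h^-1%g w; rewrite aff_actM -/w' => gw.
have hw : aff_act h w' = w by rewrite -aff_actM mulgV aff_act1.
have : x *m aff_act g w' = x *m aff_act h w' by rewrite gw hw.
by rewrite !mulmxDr !mulmxA e => /addIr.
Qed.

Lemma aff_lin_inj : {in S &, injective (@aff_lin n)}.
Proof.
move=> g h gS hS e; have: aff_trans g = aff_trans h.
  by apply: eq_mul_rV => x; apply: intersecting_agree; rewrite // /aff_mx e.
by case: g h e {gS hS} => [M v] [M' v'] /= -> ->.
Qed.

(** The function F of two row vectors, coded as one row of length [d + d]. The choice of [g] does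
    not matter, by [intersecting_agree]; the value is 0 where no element of [S] applies. *)
Definition functional (z : 'rV['F_2]_(d + d)) : 'F_2 :=
  if [pick g in S | lsubmx z *m aff_mx g == rsubmx z] is Some g
  then (lsubmx z *m aff_trans g) 0 0 else 0.

Lemma functionalE g (x : row) : g \in S ->
  functional (row_mx x (x *m aff_mx g)) = (x *m aff_trans g) 0 0.
Proof.
move=> gS; rewrite /functional row_mxKl row_mxKr.
case: pickP => [h /andP[hS /eqP e] | /(_ g)]; last by rewrite gS eqxx.
by rewrite (intersecting_agree hS gS e).
Qed.

Lemma functionalD g (x y : row) : g \in S ->
  functional (row_mx (x + y) ((x + y) *m aff_mx g)) =
  functional (row_mx x (x *m aff_mx g)) + functional (row_mx y (y *m aff_mx g)).
Proof. by move=> gS; rewrite !functionalE // mulmxDl mxE. Qed.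

(** [gamma] stacks the candidate [beta] on top of [alpha], so that [row_mx x y *m gamma] is
    [x beta + y alpha]. *)
Definition defect (gamma : 'cV['F_2]_(d + d)) g : 'cV['F_2]_d :=
  aff_act g (dsubmx gamma) - usubmx gamma.

Lemma defect0 gamma g :
  (defect gamma g == 0) = (g \in canonical_set (dsubmx gamma) (usubmx gamma)).
Proof. by rewrite inE subr_eq0. Qed.

Lemma mul_defect gamma g (x : row) : g \in S ->
  (x *m defect gamma g) 0 0 =
  functional (row_mx x (x *m aff_mx g)) +
    (row_mx x (x *m aff_mx g) *m gamma) 0 0.
Proof.
move=> gS; rewrite functionalE // -{2}[gamma]vsubmxK mul_row_col.
rewrite /defect /aff_act !(mulmxDr, mulmxN) mulmxA !mxE -addrA; congr (_ + _).
rewrite addrC; congr (_ + _).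
by apply/eqP; rewrite -subr_eq0 -opprD oppr_eq0 F2_addxx.
Qed.

(* The map of the right-hand side is at most |GL| / |row_frees n m| to one. *)
Lemma card_transport m (E : {set 'M['F_2]_(m, d) * AGL n}) :
  (forall p, p \in E -> row_free p.1 /\ p.2 \in S) ->
  (#|E| * #|row_frees n m| <=
   #|[set (p.1, p.1 *m aff_mx p.2) | p in E]| * #|'GL_n(2)%g|)%N.
Proof.
move=> E_ok; set f := fun p => _; set I := imset _ _.
rewrite -sum1_card (partition_big f (mem I)) /=; last first.
  by move=> p; apply: imset_f.
rewrite big_distrl -sum_nat_const /=; apply: leq_sum => _ /imsetP[q qE ->].
have [q1 q2S] := E_ok q qE.
have q12 : row_free (q.1 *m aff_mx q.2) by rewrite row_freeM_GL.
rewrite -(card_GLfiber q1 q12) leq_mul2r sum1dep_card; apply/orP; right.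
(* Within a fiber the rows [p.1] are fixed, so [p] is determined by the linear part of [p.2], which
   lies in a [GLfiber]. *)
rewrite -(@card_in_imset _ _ (fun p => aff_lin p.2)).
  apply/subset_leq_card/subsetP => M /imsetP[p]; rewrite !inE.
  by case/andP=> pE /eqP[e1 e2] ->; rewrite -e2 e1.
move=> p p'; rewrite !inE => /andP[pE /eqP[e1 e2]] /andP[p'E /eqP[e1' e2']] e.
have [_ pS] := E_ok p pE; have [_ p'S] := E_ok p' p'E.
rewrite [p]surjective_pairing [p']surjective_pairing e1 e1'.
by rewrite (aff_lin_inj pS p'S e).
Qed.

(** Independent rows [a], [b] and an element of [S] with linear part [M] give a good pair
    [(a, a M)], [(b, b M)]; [card_transport] bounds the number of such pairs from below. *)
Lemma card_linearity_bad :
  (#|linearity_bad functional| * #|'GL_n(2)%g| +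
     #|S| * ((2 ^ d).-1 * (2 ^ d).-2) ^ 2
   <= 2 ^ (d * 4) * #|'GL_n(2)%g|)%N.
Proof.
pose E := setX (row_frees n (1 + 1)) S.
have E_ok p : p \in E -> row_free p.1 /\ p.2 \in S by rewrite !inE => /andP[].
have := card_transport E_ok; set I := imset _ _.
rewrite cardsX card_row_frees2 => I_ge.
pose c (q : 'M['F_2]_(1 + 1, d) * 'M['F_2]_(1 + 1, d)) :=
  (row_mx (usubmx q.1) (usubmx q.2), row_mx (dsubmx q.1) (dsubmx q.2)).
have c_inj : injective c.
  move=> [X Y] [X' Y'] [/eq_row_mx[eu eu'] /eq_row_mx[ed ed']].
  by rewrite -[X]vsubmxK -[Y]vsubmxK eu eu' ed ed' !vsubmxK.
have: (#|c @: I| <= #|~: linearity_bad functional|)%N.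
  apply/subset_leq_card/subsetP => _ /imsetP[_ /imsetP[[X g] + ->] ->].
  move=> /E_ok[_ /= gS].
  rewrite !inE negbK /= add_row_mx -[X]vsubmxK mul_col_mx !col_mxKu !col_mxKd.
  by rewrite -mulmxDl functionalD.
rewrite (card_imset _ c_inj) => I_le.
have := cardsC (linearity_bad functional).
rewrite card_prod !card_rV_F2 -expnD => cardC.
rewrite (_ : d * 4 = d + d + (d + d))%N; last by lia.
rewrite -cardC mulnDl leq_add2l (leq_trans _ (leq_mul I_le (leqnn _))) //.
by apply: leq_trans I_ge; rewrite -mulnn mulnA [(#|S| * _)%N]mulnC.
Qed.

(** For a nonzero defect, half of all rows [x] detect it, and each of them gives a point [(x, x M)]
    where the functional differs from [gamma]. *)
Lemma card_noncanonical gamma :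
  (#|[set g in S | defect gamma g != 0%R]| * 2 ^ d * (2 ^ d).-1 <=
   2 * #|[set z | (functional z != (z *m gamma) 0 0)%R]| * #|'GL_n(2)%g|)%N.
Proof.
set A := [set g in S | _]; set Err := [set z | _].
pose E := [set p : row * AGL n |
  ((p.1 *m defect gamma p.2) 0 0 != 0) && (p.2 \in A)].
have E_ok p : p \in E -> row_free p.1 /\ p.2 \in S.
  rewrite !inE => /and3P[xu gS _]; split=> //.
  by rewrite row_free_rV; apply: contraNneq xu => ->; rewrite mul0mx mxE.
have cardE : (2 * #|E| = #|A| * 2 ^ d)%N.
  have -> : #|E| =
      (\sum_(x : row) #|[set g in A | ((x *m defect gamma g) 0 0 != 0)%R]|)%N.
    rewrite -(card_pair_dep predT (fun x g => (g \in A) && _)).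
    by apply: eq_card => p; rewrite !inE andbC.
  rewrite card_exchange big_distrr -sum_nat_const; apply: eq_bigr => g.
  by rewrite inE => /andP[_]; apply: card_nonorthogonal.
have := card_transport E_ok; set I := imset _ _.
rewrite card_row_frees1 => I_ge.
have : (#|(fun q => row_mx q.1 q.2) @: I| <= #|Err|)%N.
  apply/subset_leq_card/subsetP => _ /imsetP[_ /imsetP[[x g] + ->] ->].
  rewrite !inE /= => /and3P[+ gS _]; rewrite mul_defect //.
  by apply: contraNneq => ->; rewrite F2_addxx.
rewrite card_imset => [I_le | [x y] [x' y'] /= /eq_row_mx[-> ->] //].
by rewrite -cardE -!mulnA leq_mul2l (leq_trans I_ge) // leq_mul2r I_le orbT.
Qed.

(** One noncanonical element excludes a fraction [3N / (8(N - 1))] of GL, where [N = 2 ^ d], from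
    the linear parts of the canonical elements of [S], leaving too few. *)
Lemma canonical_of_few_noncanonical gamma : (1 < d)%N ->
  (8 * (#|'GL_n(2)%g| + #|[set g in S | defect gamma g != 0%R]|) * (2 ^ d).-1 <
   8 * #|S| * (2 ^ d).-1 + 3 * 2 ^ d * #|'GL_n(2)%g|)%N ->
  S \subset canonical_set (dsubmx gamma) (usubmx gamma).
Proof.
move=> d_gt1; set A := [set g in S | _] => few.
apply/subsetP => g gS; rewrite -defect0; apply: contraLR few => u0.
rewrite -leqNgt; have := card_meeting_set (aff_lin g) d_gt1 u0.
set B := meeting_set _ _ => B_ge.
(* By [mul_defect], elements of [S] whose linear parts agree on [x] have defects that agree on
   [x]. *)
have disj : [disjoint B & (@aff_lin n) @: (S :\: A)].
  apply/pred0P => M /=; apply/negP => /andP[+ /imsetP[h + eM]].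
  rewrite {}eM !inE => /existsP[x /andP[xu /eqP e]] /andP[+ hS].
  rewrite hS negbK => /eqP h0; move: xu.
  have {}e : x *m aff_mx g = x *m aff_mx h := esym e.
  by rewrite mul_defect // e -mul_defect // h0 mulmx0 mxE eqxx.
have : (#|B :|: (@aff_lin n) @: (S :\: A)| <= #|'GL_n(2)%g|)%N.
  by apply/subset_leq_card/subsetP => M; rewrite !inE.
rewrite cardsU (eqP (_ : B :&: _ == set0)) ?setI_eq0 // cards0 subn0.
rewrite card_in_imset; last first.
  by move=> h k /setDP[hS _] /setDP[kS _]; apply: aff_lin_inj.
have AS : A \subset S by apply/subsetP => h; rewrite inE => /andP[].
rewrite cardsD (setIidPr AS).
move: (subset_leq_card AS) => AS_le le.
apply: (leq_trans (leq_add (leqnn _) B_ge)).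
rewrite -mulnDl -mulnDr leq_mul2r leq_mul2l /=; apply/orP; right.
by rewrite -(subnK AS_le) addnAC leq_add2r addnC.
Qed.

End IntersectingSet.

(** * The case of full density *)

Section BiadditiveSplitting.

Variable V : zmodType.
Hypothesis addxx : forall x : V, x + x = 0.

Lemma addxx_neq0 (x y : V) : x != y -> x + y != 0.
Proof. by apply: contraNneq => e; apply/eqP/(addIr y); rewrite e addxx. Qed.

(** Adding [k] to [r] absorbs the constant, and the value 0 at 0 covers the degenerate cases. *)
Lemma additive_off_zero (r : V -> 'F_2) (k : 'F_2) :
  (forall a b, a != 0 -> b != 0 -> a != b -> r (a + b) = r a + r b + k) ->
  {morph (fun a => if a == 0 then 0 else r a + k) : a b / a + b}.
Proof.
move=> rD a b /=; have [-> | a0] := eqVneq a 0; first by rewrite !add0r.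
have [-> | b0] := eqVneq b 0; first by rewrite !addr0 (negPf a0).
have [-> | ab] := eqVneq a b; first by rewrite addxx eqxx F2_addxx.
by rewrite (negPf (addxx_neq0 ab)) rD //; ring.
Qed.

Variables (F : V -> V -> 'F_2) (e0 e1 : V).
Hypotheses (e0_neq0 : e0 != 0) (e1_neq0 : e1 != 0) (e0_neq_e1 : e0 != e1).
Hypothesis FD : forall a b c e, a != 0 -> b != 0 -> a != b ->
  c != 0 -> e != 0 -> c != e -> F (a + b) (c + e) = F a c + F b e.

(* Swapping [c] and [e] in [FD] gives [F a c + F b e = F a e + F b c], so [F]
   is the sum of a function of [a] and a function of [c]. *)
Lemma biadditive_split : exists p q : V -> 'F_2,
  [/\ {morph p : x y / x + y}, {morph q : x y / x + y} &
      forall a c, a != 0 -> c != 0 -> F a c = p a + q c].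
Proof.
pose p a := F a e0; pose q c := F e0 c + F e0 e0.
have Fpq a c : a != 0 -> c != 0 -> F a c = p a + q c.
  move=> a0 c0; rewrite /p /q.
  have [-> | ae] := eqVneq a e0; first by rewrite addrCA F2_addxx addr0.
  have [-> | ce] := eqVneq c e0; first by rewrite F2_addxx addr0.
  have ex : F a c + F e0 e0 = F a e0 + F e0 c.
    by rewrite -!FD // 1?eq_sym // [e0 + c]addrC.
  by rewrite -[LHS]addr0 -(F2_addxx (F e0 e0)) addrA ex addrA.
have pqD a b c e : a != 0 -> b != 0 -> a != b -> c != 0 -> e != 0 -> c != e ->
    p (a + b) + q (c + e) = p a + q c + (p b + q e).
  by move=> *; rewrite -!Fpq ?addxx_neq0 // FD.
(* The same constant measures the failure of additivity of [p] and of [q], so correcting both leaves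
   [p a + q c] unchanged. *)
pose k := q (e0 + e1) + q e0 + q e1.
have pD a b : a != 0 -> b != 0 -> a != b -> p (a + b) = p a + p b + k.
  move=> a0 b0 ab.
  rewrite -[LHS]addr0 -(F2_addxx (q (e0 + e1))) addrA pqD //; rewrite /k; ring.
have qD c e : c != 0 -> e != 0 -> c != e -> q (c + e) = q c + q e + k.
  move=> c0 e_0 ce.
  rewrite -[LHS]add0r -(F2_addxx (p (e0 + e1))) -addrA pqD // pD //.
  transitivity (q c + q e + k + (p e0 + p e0) + (p e1 + p e1)); first by ring.
  by rewrite !F2_addxx !addr0.
exists (fun a => if a == 0 then 0 else p a + k).
exists (fun c => if c == 0 then 0 else q c + k).
split; [exact: additive_off_zero | exact: additive_off_zero |].
move=> a c a0 c0; rewrite (negPf a0) (negPf c0) Fpq //.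
by rewrite addrACA F2_addxx addr0.
Qed.

End BiadditiveSplitting.

Lemma GL1_eq (M M' : {'GL_1(2)}) : M = M'.
Proof.
suff M1 (A : {'GL_1(2)}) : GLval A = 1%:M by apply/val_inj; rewrite /= !M1.
have := GL_det A; rewrite det_mx11 => A0; rewrite [LHS]mx11_scalar.
by rewrite (F2_neq A0 (_ : 1 != 0)).
Qed.

Lemma full_intersecting n (S : {set AGL n.+1}) :
  intersecting_set S -> (#|'GL_(n.+1)(2)%g| <= #|S|)%N ->
  exists alpha beta : F2vec n.+1, S \subset canonical_set alpha beta.
Proof.
move=> S_int S_ge.
(* In dimension 1 there are no two distinct nonzero rows, but GL is trivial and [S] has at most one
   element. *)
case: n => [|n] in S S_int S_ge *.
  have [-> | [g gS]] := set_0Vmem S; first by exists 0, 0; rewrite sub0set.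
  exists 0, (aff_trans g); apply/subsetP => h hS.
  by rewrite inE /aff_act mulmx0 addr0 (aff_lin_inj S_int hS gS (GL1_eq _ _)).
have all_lin M : exists2 g, g \in S & aff_lin g = M.
  have : M \in (@aff_lin n.+2) @: S; last by case/imsetP => g gS ->; exists g.
  suff -> : (@aff_lin n.+2) @: S = 'GL_n.+2(2)%g by rewrite inE.
  by apply/eqP; rewrite eqEcard subsetT (card_in_imset (aff_lin_inj S_int)).
pose F (a c : 'rV['F_2]_n.+2) := functional S (row_mx a c).
have FD a b c e : a != 0 -> b != 0 -> a != b -> c != 0 -> e != 0 -> c != e ->
    F (a + b) (c + e) = F a c + F b e.
  (* Some [M] takes [a], [b] to [c], [e], and by full density it is the linear part of an element of
     [S]. *)
  move=> a0 b0 ab c0 e0 ce.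
  have free_ab : row_free (col_mx a b) by rewrite row_free_col_F2 a0 b0.
  have free_ce : row_free (col_mx c e) by rewrite row_free_col_F2 c0 e0.
  have [M] := GL_transitive (n := n.+2) free_ab free_ce; rewrite mul_col_mx.
  have [g gS <-] := all_lin M => /eq_col_mx[<- <-].
  by rewrite -mulmxDl /F functionalD.
have e_neq0 i : delta_mx 0 i != 0 :> 'rV['F_2]_n.+2.
  by apply/rV0Pn; exists i; rewrite mxE !eqxx.
have e01 : delta_mx 0 ord0 != delta_mx 0 ord_max :> 'rV['F_2]_n.+2.
  by apply/eqP => /matrixP/(_ 0 ord0)/eqP; rewrite !mxE.
have [p [q [pD qD Fpq]]] :=
  biadditive_split (@addxx_F2 _ _) (e_neq0 _) (e_neq0 _) e01 FD.
have [|gamma pq] := @F2_additive_repr (n.+2 + n.+2)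
    (fun z => p (lsubmx z) + q (rsubmx z)).
  by move=> x y; rewrite !raddfD /= pD qD addrACA.
exists (dsubmx gamma), (usubmx gamma); apply/subsetP => g gS.
rewrite -defect0; apply/eqP/eq_mul_rV => x; rewrite mulmx0.
have [-> | x0] := eqVneq x 0; first by rewrite mul0mx.
apply/matrixP => i j; rewrite !ord1 (mul_defect S_int _ _ gS) -pq.
rewrite row_mxKl row_mxKr.
rewrite -[functional _ _]/(F x (x *m aff_mx g)) Fpq ?F2_addxx ?mxE //.
by rewrite -row_free_rV (row_freeM_GL (n := n.+2)) row_free_rV.
Qed.

(** * Stability in large dimension *)

(** The failure probability is at most [1/100 + 6/N], below [7/200] for [N >= 256]. *)
Lemma linearity_bad_bound N bad s G : (256 <= N)%N -> (0 < G)%N ->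
  (bad * G + s * (N.-1 * N.-2) ^ 2 <= N ^ 4 * G)%N -> (99 * G <= 100 * s)%N ->
  (200 * bad <= 7 * N ^ 4)%N.
Proof.
move=> N_ge G_gt0 le s_ge.
have P_ge : (N ^ 4 <= (N.-1 * N.-2) ^ 2 + 6 * N ^ 3)%N.
  by case: N N_ge {le} => [|[|k]] //= _; rewrite !expnS expn0; nia.
have N34 : (256 * N ^ 3 <= N ^ 4)%N.
  by rewrite [in leqRHS]expnS leq_mul2r N_ge orbT.
have : (100 * bad + 99 * (N.-1 * N.-2) ^ 2 <= 100 * N ^ 4)%N.
  rewrite -(leq_pmul2r G_gt0).
  move: (N ^ 4)%N ((N.-1 * N.-2) ^ 2)%N le {P_ge N34} => w P le.
  have : (P * (99 * G) <= P * (100 * s))%N by rewrite leq_mul2l s_ge orbT.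
  by nia.
by lia.
Qed.

(** The bounds give [err <= 0.07 N^2] and [a (N - 1) <= 0.14 N G]; hence
    [8 (G + a - s) (N - 1) <= 1.2 N G], well below [3 N G]. *)
Lemma noncanonical_bound N bad err a s G : (256 <= N)%N -> (0 < G)%N ->
  (200 * bad <= 7 * N ^ 4)%N -> (err * N ^ 2 <= 2 * bad)%N ->
  (a * N * N.-1 <= 2 * err * G)%N -> (99 * G <= 100 * s)%N ->
  (8 * (G + a) * N.-1 < 8 * s * N.-1 + 3 * N * G)%N.
Proof.
move=> N_ge G_gt0 bad_le err_le a_le s_ge.
have err_N : (100 * err <= 7 * N ^ 2)%N.
  have N2 : (0 < N ^ 2)%N by rewrite expn_gt0 (leq_trans _ N_ge).
  rewrite -(leq_pmul2r N2); move: bad_le err_le; rewrite (expnD N 2 2).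
  by move: (N ^ 2)%N => q; nia.
have : (50 * (a * N.-1) <= 7 * N * G)%N.
  have N0 : (0 < N)%N by rewrite (leq_trans _ N_ge).
  rewrite -(leq_pmul2r N0).
  have : (100 * err * G <= 7 * N ^ 2 * G)%N by rewrite leq_mul2r err_N orbT.
  by rewrite -mulnn; nia.
have := leq_mul (leqnn N.-1) s_ge.
case: N N_ge {bad_le err_le a_le err_N} => // N _ /=.
by nia.
Qed.

Lemma stability_large n (S : {set AGL n}) : (8 <= n.-1.+1)%N ->
  intersecting_set S -> (99 * #|'GL_n(2)%g| <= 100 * #|S|)%N ->
  exists alpha beta : F2vec n, S \subset canonical_set alpha beta.
Proof.
move=> d_ge S_int S_ge.
have N_ge : (256 <= 2 ^ n.-1.+1)%N by rewrite (@leq_exp2l 2 8).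
have G_gt0 : (0 < #|'GL_n(2)%g|)%N by exact: cardG_gt0.
have := card_linearity_bad S_int; rewrite expnM => bad_le.
have {}bad_le := linearity_bad_bound N_ge G_gt0 bad_le S_ge.
have W : #|{: 'rV['F_2]_(n.-1.+1 + n.-1.+1)}| = ((2 ^ n.-1.+1) ^ 2)%N.
  by rewrite card_rV_F2 expnD mulnn.
have [|majD] := linearity_test (F := functional S) (@addxx_F2 _ _).
  rewrite W -expnM; have : (0 < (2 ^ n.-1.+1) ^ 4)%N by rewrite !expn_gt0.
  by move: bad_le; lia.
have [gamma maj] := F2_additive_repr majD; rewrite W.
rewrite (eq_card (B := [set z | functional S z != (z *m gamma) 0 0])).
  2: by move=> z; rewrite !inE maj.
move=> err_le; exists (dsubmx gamma), (usubmx gamma).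
apply: canonical_of_few_noncanonical => //; first exact: leq_trans d_ge.
exact: noncanonical_bound bad_le err_le (card_noncanonical S_int gamma) S_ge.
Qed.

(** * The choice of the constant *)

Import Order.TTheory Num.Theory.

Theorem theorem1p5 (R : realType) :
  exists c0 : R, c0 < 1 /\
    forall n : nat, (0 < n)%N ->
    forall S : {set AGL n},
      intersecting_set S ->
      c0 * #|'GL_n(2)%g|%:R <= #|S|%:R ->
      exists alpha beta : F2vec n, S \subset canonical_set alpha beta.
Proof.
(* [K] exceeds the order of GL for every [n < 8], so there a deficit below [G / K] forces
   [G <= #|S|]; as [K >= 100], it yields density 99/100 for the other [n]. *)
pose L := (\sum_(n < 8) #|'GL_n(2)%g|)%N; pose K := (100 * L.+1)%N.
have K_gt0 : 0 < K%:R :> R by rewrite ltr0n.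
exists (1 - K%:R^-1); split; first by rewrite ltrBlDr ltrDl invr_gt0.
move=> n n_gt0 S S_int; set G := #|'GL_n(2)%g| => S_ge.
have {}S_ge : (K * G <= K * #|S| + G)%N.
  rewrite -(ler_nat R) natrD !(natrM _ K) -lerBlDr.
  have := ler_wpM2l (ltW K_gt0) S_ge.
  by rewrite mulrA mulrBr mulr1 divff ?gt_eqF // mulrBl mul1r.
have [n_lt8 | n_ge8] := ltnP n 8.
  have G_le : (G <= L)%N by rewrite /L (bigD1 (Ordinal n_lt8)) //= leq_addr.
  case: n n_gt0 => // n _ in S S_int G S_ge n_lt8 G_le *.
  apply: full_intersecting => //; rewrite -/G leqNgt; apply/negP => S_lt.
  by move: S_ge S_lt G_le; rewrite /K; nia.
apply: stability_large => //; first by rewrite prednK.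
by rewrite -/G; move: S_ge; rewrite /K; nia.
Qed.
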